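(* Let $\{(\boldsymbol{x}^{(i)},y^{(i)})\}_{i=1}^N$ be a finite labelled sample with $N\ge 1$, $\boldsymbol{x}^{(i)}\in\mathcal{X}$, $y^{(i)}\in\{\omega_1,\dots,\omega_K\}$, and let $\boldsymbol{\theta}^{(1)},\dots,\boldsymbol{\theta}^{(M)}$ ($M\ge 1$) be the members of an ensemble $\boldsymbol{\Theta}$, with ensemble prediction $P(\omega\mid\boldsymbol{x};\boldsymbol{\Theta})=\frac1M\sum_{m=1}^M P(\omega\mid\boldsymbol{x};\boldsymbol{\theta}^{(m)})$. Let $\hat y^{(i)}_m$ and $\hat y^{(i)}_{E}$ be the top labels on $\boldsymbol{x}^{(i)}$ of member $m$ and of the ensemble, respectively. If all the members and the ensemble are globally top-label calibrated on the sample, then the accuracy of the ensemble is no better than the average accuracy of the members: $$\frac1N\sum_{i=1}^N\delta(y^{(i)},\hat y^{(i)}_{E})\;\le\;\frac1M\sum_{m=1}^M\Big(\frac1N\sum_{i=1}^N\delta(y^{(i)},\hat y^{(i)}_m)\Big).$$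
   Context: $\mathcal{X}\subseteq\mathbb{R}^d$ is the input space and $\{\omega_1,\dots,\omega_K\}$ is the finite set of classes. A model $\boldsymbol{\theta}$ assigns to each $\boldsymbol{x}\in\mathcal{X}$ a probability distribution $P(\cdot\mid\boldsymbol{x};\boldsymbol{\theta})$ on the classes. $\delta(s,t)=1$ if $s=t$ and $0$ otherwise. Top labels: $\hat y^{(i)}_m=\arg\max_\omega P(\omega\mid\boldsymbol{x}^{(i)};\boldsymbol{\theta}^{(m)})$ and $\hat y^{(i)}_E=\arg\max_\omega \frac1M\sum_{m=1}^M P(\omega\mid\boldsymbol{x}^{(i)};\boldsymbol{\theta}^{(m)})$ (a maximizer; when ties occur, any fixed choice of maximizer is used). Global top-label calibration of a predictor $P(\cdot\mid\boldsymbol{x})$ (a member or the ensemble) with top labels $\hat y^{(i)}$ on the sample means $$\frac1N\sum_{i=1}^N P(\hat y^{(i)}\mid\boldsymbol{x}^{(i)})=\frac1N\sum_{i=1}^N\delta(y^{(i)},\hat y^{(i)}).$$ *)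

(* Defs.v *)
From HB Require Import structures.
From mathcomp Require Import all_boot all_order all_algebra.
From mathcomp Require Import classical_sets reals.

Set Implicit Arguments.
Unset Strict Implicit.
Unset Printing Implicit Defensive.

Import Order.TTheory GRing.Theory Num.Theory.
Local Open Scope ring_scope.

(* [P x w] is P(w | x).  The distribution laws are kept separate, in
   [is_probabilistic], so that the ensemble average is a predictor for every
   [M], including the degenerate [M = 0]. *)
Definition predictor (R : realType) (d : nat) (X : set 'rV[R]_d) (K : nat) :=
  X -> 'I_K -> R.

Definition is_probabilistic (R : realType) (d : nat) (X : set 'rV[R]_d)
    (K : nat) (P : predictor X K) : Prop :=
  forall x : X, (forall w, 0 <= P x w) /\ \sum_(w < K) P x w = 1.

Definition ensemble (R : realType) (d : nat) (X : set 'rV[R]_d) (K M : nat)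
    (P : 'I_M -> predictor X K) : predictor X K :=
  fun x w => M%:R^-1 * \sum_(m < M) P m x w.

(* Ties are left open: [yhat i] is any maximizer of P(. | x i), and the choice
   may depend on the sample index [i]. *)
Definition are_top_labels (R : realType) (d : nat) (X : set 'rV[R]_d)
    (K N : nat) (P : predictor X K) (x : 'I_N -> X) (yhat : 'I_N -> 'I_K) :
    Prop :=
  forall (i : 'I_N) (w : 'I_K), P (x i) w <= P (x i) (yhat i).

Definition accuracy (R : realType) (K N : nat) (y yhat : 'I_N -> 'I_K) : R :=
  N%:R^-1 * \sum_(i < N) (y i == yhat i)%:R.

Definition globally_top_label_calibrated (R : realType) (d : nat)
    (X : set 'rV[R]_d) (K N : nat) (P : predictor X K) (x : 'I_N -> X)
    (y yhat : 'I_N -> 'I_K) : Prop :=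
  N%:R^-1 * \sum_(i < N) P (x i) (yhat i) = accuracy R y yhat.

(* Main.v *)
(* By calibration, accuracies are mean confidences. The confidence of the
   ensemble at its top label is the mean over the members of their
   probabilities for that label, each at most the member's own top
   probability. *)
Require Import Defs.
From HB Require Import structures.
From mathcomp Require Import all_boot all_order all_algebra.
From mathcomp Require Import classical_sets reals.

Set Implicit Arguments.
Unset Strict Implicit.
Unset Printing Implicit Defensive.

Import Order.TTheory GRing.Theory Num.Theory.
Local Open Scope ring_scope.

Theorem proposition1 (R : realType) (d K N M : nat) (X : set 'rV[R]_d)
    (Theta : Type) (P : Theta -> predictor X K)
    (x : 'I_N -> X) (y : 'I_N -> 'I_K) (theta : 'I_M -> Theta)
    (yhat : 'I_M -> 'I_N -> 'I_K) (yhatE : 'I_N -> 'I_K) :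
  (1 <= N)%N ->
  (1 <= M)%N ->
  (forall t : Theta, is_probabilistic (P t)) ->
  (forall m : 'I_M, are_top_labels (P (theta m)) x (yhat m)) ->
  are_top_labels (ensemble (fun m : 'I_M => P (theta m))) x yhatE ->
  (forall m : 'I_M,
     globally_top_label_calibrated (P (theta m)) x y (yhat m)) ->
  globally_top_label_calibrated
    (ensemble (fun m : 'I_M => P (theta m))) x y yhatE ->
  accuracy R y yhatE <= M%:R^-1 * \sum_(m < M) accuracy R y (yhat m).
Proof.
move=> _ _ _ top_members _ cal_members <-.
(* [cal_members] is used from right to left under the sum over [m], so that both sides are averages
   of probabilities. *)
rewrite -(eq_bigr _ (fun m _ => cal_members m)).
(* [mulrCA] brings [N%:R^-1] to the front on the right, to match the factor on the left. *)
rewrite -mulr_sumr mulrCA ler_wpM2l ?invr_ge0 ?ler0n //.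
rewrite /ensemble -mulr_sumr ler_wpM2l ?invr_ge0 ?ler0n //.
rewrite exchange_big /=.
(* For each [m] and [i], the ensemble's label [yhatE i] is the competitor [w] in [top_members]. *)
by do 2!apply: ler_sum => ? _; apply: top_members.
Qed.
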